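(* Let $Y$ be a real vector space, $f:Y\to\overline{\mathbb{R}}$, $A:=\operatorname{epi}f\subseteq Y\times\mathbb{R}$ and $k:=(0_Y,-1)\in Y\times\mathbb{R}$. Assume that $f$ is not a constant function with the function value $+\infty$ or $-\infty$. Then: (a) $f$ is convex if and only if $\varphi_{A,k}$ is convex. (b) $f$ is positively homogeneous if and only if $\varphi_{A,k}$ is positively homogeneous. (c) $f$ is subadditive if and only if $\varphi_{A,k}$ is subadditive. (d) $f$ is sublinear if and only if $\varphi_{A,k}$ is sublinear.
   Context: $\overline{\mathbb{R}}=\mathbb{R}\cup\{-\infty,+\infty\}$, $\inf\emptyset=+\infty$, $\mathbb{R}_{+}=\{x\in\mathbb{R}:x\ge0\}$. For a real vector space $Z$ and $\varphi:Z\to\overline{\mathbb{R}}$, $\operatorname{epi}\varphi=\{(z,t)\in Z\times\mathbb{R}:\varphi(z)\le t\}$. A set $C$ is a cone if $\lambda C\subseteq C$ for all $\lambda\in\mathbb{R}_{+}$. The functional $\varphi$ is convex if $\operatorname{epi}\varphi$ is convex; positively homogeneous if $\operatorname{epi}\varphi$ is a nonempty cone; subadditive if $\operatorname{epi}\varphi+\operatorname{epi}\varphi\subseteq\operatorname{epi}\varphi$; sublinear if $\operatorname{epi}\varphi$ is a nonempty convex cone. The Gerstewitz functional $\varphi_{A,k}:Y\times\mathbb{R}\to\overline{\mathbb{R}}$ is $\varphi_{A,k}((y,s))=\inf\{t\in\mathbb{R}:(y,s)\in A+tk\}$. *)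

(* Defs.v *)
From HB Require Import structures.
From mathcomp Require Import all_boot all_order all_algebra.
From mathcomp Require Import boolp classical_sets functions reals.
From mathcomp Require Import constructive_ereal ereal convex.

Set Implicit Arguments.
Unset Strict Implicit.
Unset Printing Implicit Defensive.

Import Order.TTheory GRing.Theory Num.Theory.
Local Open Scope classical_set_scope.
Local Open Scope ring_scope.

(* The real line, as a factor of a product vector
   space, is written R^o: this alias carries the structure of R-module over
   itself, so that Z * R^o is again an lmodType R. *)

Section Functionals.
Context {R : realType}.

Definition epi (Z : lmodType R) (phi : Z -> \bar R) : set (Z * R^o) :=
  [set p | (phi p.1 <= (p.2 : R)%:E)%E].

(* The scalar 0 is allowed, so a nonempty cone contains the origin; the empty
   set is a cone. *)
Definition cone (Z : lmodType R) (C : set Z) : Prop :=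
  forall l : R, 0 <= l -> [set l *: z | z in C] `<=` C.

Definition convex_functional (Z : lmodType R) (phi : Z -> \bar R) : Prop :=
  convex_set (epi phi).

Definition positively_homogeneous (Z : lmodType R) (phi : Z -> \bar R) : Prop :=
  epi phi !=set0 /\ cone (epi phi).

Definition subadditive (Z : lmodType R) (phi : Z -> \bar R) : Prop :=
  [set p + q | p in epi phi & q in epi phi] `<=` epi phi.

Definition sublinear (Z : lmodType R) (phi : Z -> \bar R) : Prop :=
  [/\ epi phi !=set0, convex_set (epi phi) & cone (epi phi)].

(* The infimum is taken in \bar R, where the empty set has infimum +oo. *)
Definition gerstewitz (Z : lmodType R) (A : set Z) (k : Z) (z : Z) : \bar R :=
  ereal_inf [set t%:E | t in [set t : R | [set a + t *: k | a in A] z]].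

End Functionals.

(* Main.v *)
Require Import Defs.
From HB Require Import structures.
From mathcomp Require Import all_boot all_order all_algebra.
From mathcomp Require Import boolp classical_sets functions reals.
From mathcomp Require Import constructive_ereal ereal convex.

(** The value of the Gerstewitz functional at (y, s) is f y - s, so its epigraph
    is the preimage of epi f under the linear map ((y, s), t) |-> (y, s + t).
    This map has the linear section (y, t) |-> ((y, 0), t), hence epi f is in
    turn a preimage of the epigraph of the functional. Being convex, a cone or
    closed under addition passes to preimages under linear maps. *)

Import Order.TTheory GRing.Theory Num.Theory.
Local Open Scope classical_set_scope.
Local Open Scope ring_scope.

Section LinearPreimage.
Context {R : realType} {Z W : lmodType R} (h : {linear W -> Z}) (C : set Z).

Lemma cone_preimage : cone C -> cone (h @^-1` C).
Proof.
by move=> cC l l0 _ [w Cw <-]; apply: (cC l l0); exists (h w); rewrite ?linearZ.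
Qed.

Lemma convex_set_preimage : convex_set C -> convex_set (h @^-1` C).
Proof.
move=> cC x y l /set_mem Cx /set_mem Cy; apply/mem_set.
have := cC (h x) (h y) l (mem_set Cx) (mem_set Cy).
(* Unfolding [conv] exposes a linear combination of [x] and [y], which [h] preserves. *)
by move/set_mem; rewrite /preimage /= /conv /= linearD !linearZ.
Qed.

Lemma add_closed_preimage :
  [set p + q | p in C & q in C] `<=` C ->
  [set p + q | p in h @^-1` C & q in h @^-1` C] `<=` h @^-1` C.
Proof.
move=> CD _ [x Cx [y Cy <-]]; apply: CD.
by exists (h x) => //; exists (h y); rewrite ?linearD.
Qed.

End LinearPreimage.

Section EpigraphMaps.
Context {R : realType} {Y : lmodType R}.

Definition absorb_height (p : (Y * R^o) * R^o) : Y * R^o :=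
  (p.1.1, p.1.2 + p.2).

Definition zero_height (p : Y * R^o) : (Y * R^o) * R^o := ((p.1, 0), p.2).

Fact absorb_height_is_linear : linear absorb_height.
Proof.
by move=> a [[y s] t] [[y' s'] t']; congr pair; rewrite /= scalerDr addrACA.
Qed.

HB.instance Definition _ := GRing.isLinear.Build R ((Y * R^o) * R^o)%type
  (Y * R^o)%type *:%R absorb_height absorb_height_is_linear.

Fact zero_height_is_linear : linear zero_height.
Proof.
by move=> a [y t] [y' t']; congr (_, _, _); rewrite /= scaler0 addr0.
Qed.

HB.instance Definition _ := GRing.isLinear.Build R (Y * R^o)%type
  ((Y * R^o) * R^o)%type *:%R zero_height zero_height_is_linear.

Lemma zero_heightK : cancel zero_height absorb_height.
Proof. by case=> y t; rewrite /absorb_height /= add0r. Qed.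

(** Adding [t *: (0, -1)] lowers the epigraph by [t], so the point of [epi f] that lands on [(y, s)]
    can only be [(y, s + t)]. *)
Lemma epi_translate (f : Y -> \bar R) (y : Y) (s t : R) :
  [set a + t *: ((0, -1) : Y * R^o) | a in epi f] (y, s)
  <-> (f y <= (s + t)%:E)%E.
Proof.
split=> [[[y' s'] /= fs' [<- <-]]|fst].
  (* Scaling in [R^o] is multiplication by conversion, which lets [mulrN1] apply. *)
  by rewrite scaler0 addr0 -[t *: _]/(t * -1) mulrN1 subrK.
exists (y, s + t) => //; congr pair; rewrite /= ?scaler0 ?addr0 //.
by rewrite -[t *: _]/(t * -1) mulrN1 addrK.
Qed.

(** By [epi_translate] the infimum runs over the reals [t] with [f y <= s + t]. Working with this
    inequality instead of the difference [f y - s] treats infinite values of [f] uniformly. *)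
Lemma epi_gerstewitz (f : Y -> \bar R) :
  epi (gerstewitz (epi f) (0, -1)) = absorb_height @^-1` epi f.
Proof.
set phi := gerstewitz _ _; apply/seteqP.
split=> -[[y s] t]; rewrite /epi /= => H; last first.
  by apply: ereal_inf_lbound; exists t => //; apply/epi_translate.
(* A bound on the infimum only provides elements of the set below [t + e], so [f y <= s + t] is
   proved up to every [e > 0]. *)
apply/lee_addgt0Pr => e e0.
have /ereal_inf_ltP[_ [u /epi_translate fu <-]] : (phi (y, s) < (t + e)%:E)%E.
  by apply: le_lt_trans H _; rewrite lte_fin ltrDl.
rewrite lte_fin => ut; apply: le_trans fu _.
by rewrite -EFinD lee_fin -addrA lerD2l ltW.
Qed.

(** Pulling back along [absorb_height] and then along its section [zero_height] is pulling back
    along the identity. *)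
Lemma epi_from_gerstewitz (f : Y -> \bar R) :
  epi f = zero_height @^-1` epi (gerstewitz (epi f) (0, -1)).
Proof.
rewrite epi_gerstewitz.
by apply/seteqP; split=> p; rewrite /= zero_heightK.
Qed.

End EpigraphMaps.

Theorem proposition19 (R : realType) (Y : lmodType R) (f : Y -> \bar R)
    (f_not_pinfty : f <> (fun=> +oo%E)) (f_not_ninfty : f <> (fun=> -oo%E)) :
  let A : set (Y * R^o) := epi f in
  let k : Y * R^o := (0, -1) in
  [/\ convex_functional f <-> convex_functional (gerstewitz A k),
      positively_homogeneous f <-> positively_homogeneous (gerstewitz A k),
      subadditive f <-> subadditive (gerstewitz A k)
    & sublinear f <-> sublinear (gerstewitz A k)].
Proof.
move=> A k; set phi := gerstewitz A k.
have epi_phi : epi phi = absorb_height @^-1` epi f := epi_gerstewitz f.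
have epi_f : epi f = zero_height @^-1` epi phi := epi_from_gerstewitz f.
(* A preimage of a nonempty set may be empty, so each direction carries a point across by one of the
   two maps. *)
have nonempty : epi f !=set0 <-> epi phi !=set0.
  split=> [[p fp]|[p]]; last by rewrite epi_phi => fp; exists (absorb_height p).
  by exists (zero_height p); rewrite epi_f in fp.
have convexE : convex_set (epi f) <-> convex_set (epi phi).
  split=> H; first by rewrite epi_phi; exact: convex_set_preimage.
  by rewrite epi_f; exact: convex_set_preimage.
have coneE : cone (epi f) <-> cone (epi phi).
  split=> H; first by rewrite epi_phi; exact: cone_preimage.
  by rewrite epi_f; exact: cone_preimage.
split.
- exact: convexE.
- by rewrite /positively_homogeneous nonempty coneE.
- split=> H; rewrite /subadditive.
    by rewrite epi_phi; exact: add_closed_preimage.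
  by rewrite epi_f; exact: add_closed_preimage.
(* A view through an equivalence works both ways, so one script serves both implications. *)
- by split=> -[/nonempty ? /convexE ? /coneE ?].
Qed.
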